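(* Let $n \ge 1$ be a natural number, written uniquely as $n = 2^{e} \cdot o$, where $e = e(n) \geq 0$ is an integer and $o = o(n)$ is an odd natural number. Then the number $h(n)$ of hamiltonian groups of order $n$ is given by $$h(n) = \begin{cases} 0, & e(n) < 3,\\ a(o(n)), & \text{otherwise,}\end{cases}$$ where $a(m)$ denotes the number of abelian groups of order $m$.
   Context: A hamiltonian group is a nonabelian group all of whose subgroups are normal. Groups are counted up to isomorphism: for a natural number $n\ge 1$, $h(n)$ is the number of isomorphism classes of hamiltonian groups of order $n$, and $a(n)$ is the number of isomorphism classes of abelian groups of order $n$. *)

(* Defs.v *)
From HB Require Import structures.
From mathcomp Require Import all_boot all_fingroup.

Set Implicit Arguments.
Unset Strict Implicit.
Unset Printing Implicit Defensive.

Local Open Scope group_scope.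

Definition hamiltonian (gT : finGroupType) (G : {set gT}) : bool :=
  ~~ abelian G && [forall H : {group gT}, (H \subset G) ==> (H <| G)].

(* The number of isomorphism classes of groups of order n satisfying P, where P
   is an isomorphism-invariant property of finite groups.  The finite groups form
   a proper class, so the classes are counted among the subgroups of 'S_n, which
   by Cayley's theorem contain a copy of every group of order n; num_isoclassesP
   below checks that this is the number of classes among all finite groups. *)
Definition num_isoclasses
    (P : forall gT : finGroupType, {set gT} -> bool) (n : nat) : nat :=
  #|equivalence_partition (fun G H : {group 'S_n} => G \isog H)
      [set G : {group 'S_n} | (#|G| == n) && P _ G]|.

Definition num_hamiltonian (n : nat) : nat := num_isoclasses hamiltonian n.

Definition num_abelian (n : nat) : nat :=
  num_isoclasses (fun gT (G : {set gT}) => abelian G) n.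

Lemma Cayley_Sn (gT : finGroupType) (G : {group gT}) (n : nat) :
  #|G| = n -> exists H : {group 'S_n}, G \isog H.
Proof.
move=> oG; have {oG} oT : #|subg_of G| = n by rewrite -cardsT -(card_isog (isog_subg G)).
subst n; set T : finGroupType := subg_of G.
have inj_f (x : T) : injective (fun i : 'I_#|T| => enum_rank (enum_val i * x)).
  by move=> i j /enum_rank_inj/mulIg/enum_val_inj.
pose f (x : T) := perm (inj_f x).
have fM : {in [set: T] &, {morph f : x y / x * y}}.
  by move=> x y _ _; apply/permP=> i; rewrite permM !permE enum_rankK mulgA.
pose fm := Morphism fM.
have inj_fm : 'injm fm.
  apply/injmP=> x y _ _ /permP/(_ (enum_rank 1)).
  by rewrite /fm /= !permE !enum_rankK !mul1g => /enum_rank_inj.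
exists [group of fm @* [set: T]].
apply: isog_trans (sub_isog (subxx _) inj_fm).
exact: (isom_isog _ _ (isom_subg G)).
Qed.

Lemma num_isoclassesP (P : forall gT : finGroupType, {set gT} -> bool) (n : nat) :
    (forall (gT rT : finGroupType) (G : {group gT}) (H : {group rT}),
       G \isog H -> P _ G = P _ H) ->
  exists K : 'I_(num_isoclasses P n) -> {group 'S_n},
    [/\ forall i, #|K i| = n /\ P _ (K i),
        forall i j, K i \isog K j -> i = j
      & forall (gT : finGroupType) (G : {group gT}),
          #|G| = n -> P _ G -> exists i, G \isog K i].
Proof.
move=> isoP; rewrite /num_isoclasses.
set R := fun _ _ => _; set D := [set _ | _].
have eqR : {in D & &, equivalence_rel R}.
  move=> G H L _ _ _; split=> [|GH]; first exact: isog_refl.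
  by apply/idP/idP; apply: isog_trans; rewrite // isog_sym.
set Q := equivalence_partition R D.
have partQ : partition Q D := equivalence_partitionP eqR.
have trX := transversalP partQ; set X := transversal Q D in trX.
have oX : #|Q| = #|X| by rewrite (card_transversal trX).
have sXD := transversal_sub trX.
have XD (i : 'I_#|X|) : enum_val i \in D by apply: (subsetP sXD) (enum_valP i).
have [_ tiQ _] := and3P partQ.
rewrite oX; exists (fun i => enum_val i); split=> [i | i j isoij | gT G oG PG].
- by have := XD i; rewrite inE => /andP[/eqP].
- apply: enum_val_inj; apply: (pblock_inj trX); rewrite ?enum_valP //.
  have /= := pblock_equivalence_partition eqR (XD i) (XD j).
  rewrite -[LHS]/(enum_val j \in pblock Q (enum_val i)) /R isoij => jQi.
  exact/esym/same_pblock.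
have [H isoGH] := Cayley_Sn oG.
have DH : H \in D.
  by rewrite inE -(card_isog isoGH) oG eqxx -(isoP _ _ _ _ isoGH).
have QH : pblock Q H \in Q by rewrite pblock_mem // (cover_partition partQ).
have Xr := repr_mem_pblock trX H QH.
set L := transversal_repr H X (pblock Q H) in Xr.
have XL : L \in X := repr_mem_transversal trX H QH.
exists (enum_rank_in XL L); rewrite enum_rankK_in //.
apply: isog_trans isoGH _.
by move: Xr; rewrite pblock_equivalence_partition // (subsetP sXD).
Qed.

Lemma hamiltonian_isog (gT rT : finGroupType) (G : {group gT}) (H : {group rT}) :
  G \isog H -> hamiltonian G = hamiltonian H.
Proof.
move=> isoGH; rewrite /hamiltonian (isog_abelian isoGH); congr (_ && _).
suff imp (aT bT : finGroupType) (A : {group aT}) (B : {group bT}) :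
    A \isog B -> [forall H : {group aT}, (H \subset A) ==> (H <| A)] ->
    [forall H : {group bT}, (H \subset B) ==> (H <| B)].
  by apply/idP/idP; apply: imp; rewrite // isog_sym.
case/isogP=> f inj_f <- /forall_inP nA; apply/forall_inP=> K sK.
by have := morphim_normal f (nA [group of f @*^-1 K] (subsetIl _ _));
   rewrite /= morphpreK.
Qed.

(* Main.v *)
Require Import Defs.
From mathcomp Require Import all_boot all_fingroup all_solvable zmodp matrix.

(** A finite hamiltonian group is exactly a direct product Q x E x A of the
quaternion group Q of order 8, an elementary abelian 2-group E and an abelian
group A of odd order (Dedekind, Baer).  In a group of order 2^e * o with o odd,
E then has order 2^(e - 3), which determines it, and A is an abelian group of
order o.  So no such group exists if e < 3, and otherwise sending G to A is a
bijection between isomorphism classes: two groups with isomorphic A are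
isomorphic ([decomposition_isog]), every A occurs ([exists_decomposition],
[decomposition_hamiltonian]), and A is recovered from G as the largest normal
subgroup of odd order ([decomposition_odd_core]).

For the structure theorem, all subgroups of G are normal if and only if every
conjugate of an element is a power of it; then [x, y] is a power both of x and
of y, so it commutes with both and commutator calculus in <x, y> is that of a
group of class 2.  Choose x noncentral of least order, then y of least order not
commuting with x.  Minimality forces x and y to have prime power order and
[x, y] to have prime order p, and p-th power arithmetic leaves only the defining
relations of the quaternion group ([noncommuting_quaternion_pair]).  In
particular, a group with all subgroups normal and no element of order 4 is
abelian.

The subgroup Q = <x, y> is thus quaternion.  An element of G can only invert or
fix x and y, as some element of Q already does, so G = Q C_G(Q)
([quaternion_pair_mul_cent]).  The centralizer C_G(Q) has no element of order 4
([cent_quaternion_pair_sqr]), so it is abelian with an elementary abelian Sylow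
2-subgroup; the latter contains the center <x^2> of Q, and a complement E of
<x^2> there, together with the odd part A of C_G(Q), completes the decomposition
([hamiltonian_decomposes]). *)

Set Implicit Arguments.
Unset Strict Implicit.
Unset Printing Implicit Defensive.

Local Open Scope nat_scope.
Local Open Scope group_scope.

(** * Groups in which every subgroup is normal *)

Definition conj_in_cycle (gT : finGroupType) (G : {set gT}) : Prop :=
  {in G &, forall x y, x ^ y \in <[x]>}.

(** Normality of all subgroups reduces to that of the cyclic ones. *)
Lemma all_normalP (gT : finGroupType) (G : {group gT}) :
  reflect (conj_in_cycle G) [forall H : {group gT}, (H \subset G) ==> (H <| G)].
Proof.
apply: (iffP forall_inP) => [nG x y Gx Gy | cG H sHG].
  have sXG: <[x]> \subset G by rewrite cycle_subG.
  have /andP[_ /normsP/(_ y Gy) nXy] := nG <[x]>%G sXG.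
  by rewrite -nXy memJ_conjg cycle_id.
rewrite /(_ <| _) sHG; apply/subsetP=> y Gy; rewrite inE.
apply/subsetP=> _ /imsetP[x Hx ->].
by apply: subsetP (cG x y (subsetP sHG x Hx) Gy); rewrite cycle_subG.
Qed.

Lemma conj_in_cycleS (gT : finGroupType) (G H : {group gT}) :
  H \subset G -> conj_in_cycle G -> conj_in_cycle H.
Proof. by move=> /subsetP sHG cG x y /sHG Gx /sHG Gy; apply: cG. Qed.

Section Commutators.

Variables (gT : finGroupType) (G : {group gT}).
Hypothesis cG : conj_in_cycle G.

Lemma commg_in_cyclel x y : x \in G -> y \in G -> [~ x, y] \in <[x]>.
Proof. by move=> Gx Gy; rewrite commgEl groupMl ?groupV ?cycle_id ?cG. Qed.

Lemma commg_in_cycler x y : x \in G -> y \in G -> [~ x, y] \in <[y]>.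
Proof.
move=> Gx Gy; rewrite commgEr groupMr ?cycle_id //.
by rewrite /= -cycleV cG ?groupV.
Qed.

Lemma commg_commutel x y : x \in G -> y \in G -> commute x [~ x, y].
Proof.
by move=> Gx Gy; have /cycleP[i ->] := commg_in_cyclel Gx Gy; apply: commuteX.
Qed.

Lemma commg_commuter x y : x \in G -> y \in G -> commute y [~ x, y].
Proof.
by move=> Gx Gy; have /cycleP[i ->] := commg_in_cycler Gx Gy; apply: commuteX.
Qed.

End Commutators.

(** Applied to a commutator c = [x, y] with x or y chosen of least order: proper
powers of that element commute with the other one, so their commutators, which
are the powers of c, vanish.  As c is nontrivial, c^r = 1 makes r the order of c,
so only one prime r can divide the order of x. *)
Lemma order_prime_power (gT : finGroupType) (c x : gT) :
    c != 1 -> x != 1 -> (forall r, prime r -> r %| #[x] -> c ^+ r = 1) ->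
  prime #[c] /\ exists a, #[x] = (#[c] ^ a.+1)%N.
Proof.
move=> c1 x1 cX.
have oc r : prime r -> r %| #[x] -> #[c] = r.
  by move=> pr rx; apply: nt_prime_order (cX r pr rx) c1.
have x_gt1 : 1 < #[x] by rewrite order_gt1.
have pc : prime #[c] by rewrite (oc _ (pdiv_prime x_gt1)) ?pdiv_dvd ?pdiv_prime.
split=> //; have /p_natP[[|a] oxa] : #[c].-nat #[x]; last by exists a.
  by apply/pnatP=> // r pr rx; rewrite (oc r pr rx) inE /=.
by rewrite oxa in x_gt1.
Qed.

(** In class 2, the p^a-th power of a product contains the 'C(p^a, 2)-th power of
the commutator; the cases where this factor survives single out the prime 2 and
the order 4. *)
Lemma prime_ndvd_bin2 p a :
  prime p -> ~~ (p %| 'C(p ^ a, 2)) -> p = 2 /\ a = 1%N.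
Proof.
move=> pp; case: (even_prime pp) => [-> | op].
  case: a => [|[|a]] //; rewrite bin2 2!expnS -mulnA mul2n doubleK.
  by rewrite -!mulnA dvdn_mulr.
case: a => [|a]; first by rewrite dvdn0.
by rewrite bin2odd ?oddX ?op ?orbT // expnS -mulnA dvdn_mulr.
Qed.

(** If x has order p^(a+1), then x^(p^a) generates the same subgroup as [x, y],
hence is a power of y.  Some power z of y thus satisfies z^(p^a) = x^-(p^a), and
(z x)^(p^a) reduces to a power of [x, y] with exponent divisible by 'C(p^a, 2).
It cannot be 1, for z x would then be an element of smaller order than x not
commuting with y; so p does not divide that exponent, which leaves only p = 2
and x, y of order 4. *)
Lemma noncommuting_quaternion_pair (gT : finGroupType) (G : {group gT}) :
    conj_in_cycle G -> ~~ abelian G ->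
  exists x y, [/\ x \in G, y \in G, #[x] = 4, y ^+ 2 = x ^+ 2 & x ^ y = x^-1].
Proof.
move=> cG nabG.
have [x0 Gx0 cx0] : exists2 x, x \in G & x \notin 'C(G) by apply/subsetPn.
pose noncentral := [pred u in G | u \notin 'C(G)].
have Px0 : noncentral x0 by rewrite /= Gx0.
case: (arg_minnP (fun x : gT => #[x]) Px0) => x /andP[Gx cx] minx.
have [y0 Gy0 cy0] : exists2 y, y \in G & y \notin 'C[x].
  by apply/subsetPn; rewrite sub_cent1.
pose noncommuting := [pred u in G | u \notin 'C[x]].
have Py0 : noncommuting y0 by rewrite /= Gy0.
case: (arg_minnP (fun x : gT => #[x]) Py0) => y /andP[Gy cy] miny.
have {cy} ncxy : ~ commute x y by move/cent1P; rewrite cent1C (negPf cy).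
have {x0 Gx0 cx0 Px0 y0 Gy0 cy0 Py0} min_x u v :
    u \in G -> v \in G -> #[u] < #[x] -> commute u v.
  move=> Gu Gv; rewrite ltnNge => /negP-ltux; apply: (centP _ v Gv).
  by apply: contraT => cu; case: ltux; apply: minx; rewrite /= Gu.
have min_y u : u \in G -> #[u] < #[y] -> commute x u.
  move=> Gu; rewrite ltnNge => /negP-ltuy; apply/cent1P; rewrite cent1C.
  by apply: contraT => cu; case: ltuy; apply: miny; rewrite /= Gu.
have le_xy : #[x] <= #[y].
  by rewrite leqNgt; apply/negP=> /(min_x y x Gy Gx)/commute_sym.
set c := [~ x, y].
have xc : commute x c := commg_commutel cG Gx Gy.
have yc : commute y c := commg_commuter cG Gx Gy.
have c1 : c != 1 by apply/eqP=> /eqP/commgP.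
have ltXr (z : gT) r : z != 1 -> prime r -> r %| #[z] -> #[z ^+ r] < #[z].
  move=> z1 pr rz; rewrite orderXdiv // ltn_Pdiv ?order_gt0 ?prime_gt1 //.
have x1 : x != 1.
  by apply/eqP=> x1; apply: ncxy; rewrite x1; apply/commute_sym/commute1.
have y1 : y != 1 by apply/eqP=> y1; apply: ncxy; rewrite y1; apply: commute1.
have [pc [a oxa]] : prime #[c] /\ exists a, #[x] = (#[c] ^ a.+1)%N.
  apply: order_prime_power => // r pr rx; rewrite -commXg //.
  by apply/eqP/commgP; apply: min_x; rewrite ?groupX ?ltXr.
have [_ [b oyb]] : prime #[c] /\ exists b, #[y] = (#[c] ^ b.+1)%N.
  apply: order_prime_power => // r pr ry; rewrite -commgX //.
  by apply/eqP/commgP; apply: min_y; rewrite ?groupX ?ltXr.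
set p := #[c] in pc oxa oyb.
have p_gt0 := prime_gt0 pc; have p_gt1 := prime_gt1 pc.
have le_ab : a <= b by move: le_xy; rewrite oxa oyb leq_exp2l.
(* The factor p ^ (b - a) is available because y has order at least that of x. *)
have [j cyj] : exists j, x ^- (p ^ a) = (y ^+ (j * p ^ (b - a))) ^+ (p ^ a).
  have oxpa : #[x ^+ (p ^ a)] = p.
    by rewrite orderXdiv oxa ?expnS ?dvdn_mull // mulnK // expn_gt0 p_gt0.
  have /eqP exc : <[x ^+ (p ^ a)]> == <[c]>.
    rewrite (eq_subG_cyclic (cycle_cyclic x)) ?cycle_subG ?mem_cycle //.
      by rewrite -!orderE oxpa.
    exact: (commg_in_cyclel cG Gx Gy).
  have /cycleP[m em] : x ^- (p ^ a) \in <[y]>.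
    have cy : c \in <[y]> := commg_in_cycler cG Gx Gy.
    have : x ^- (p ^ a) \in <[c]> by rewrite -exc groupV cycle_id.
    by apply: subsetP; rewrite cycle_subG.
  have : p ^ b %| m.
    rewrite -(dvdn_pmul2l p_gt0) -expnS -oyb mulnC order_dvdn expgM -em.
    by rewrite expVgn -{2}oxpa expg_order invg1.
  by case/dvdnP=> j ej; exists j; rewrite em ej -expgM -mulnA -expnD subnK.
set z := y ^+ (j * p ^ (b - a)) in cyj.
have Gz : z \in G by rewrite groupX.
have czx : [~ x, z] = c ^+ (j * p ^ (b - a)) by rewrite commgX.
have zxi : (z * x) ^+ (p ^ a) = c ^+ (j * p ^ (b - a) * 'C(p ^ a, 2)).
  rewrite expMg_Rmul; [|exact: (commg_commutel cG) | exact: (commg_commuter cG)].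
  by rewrite -cyj mulVg mul1g czx -expgM.
have zxi1 : (z * x) ^+ (p ^ a) != 1.
  rewrite -order_dvdn; apply/negP=> dv.
  have lt_zx : #[z * x] < #[x].
    by rewrite (leq_ltn_trans (dvdn_leq _ dv)) ?expn_gt0 ?p_gt0 // oxa ltn_exp2l.
  have cyzx := commute_sym (min_x _ y (groupM Gz Gx) Gy lt_zx).
  apply: ncxy; apply: commute_sym; rewrite -[x](mulKg z).
  by apply: commuteM => //; apply/commuteV/commuteX.
have [p2 a1 b1] : [/\ p = 2, a = 1%N & b = 1%N].
  move: zxi1; rewrite zxi -order_dvdn -/p => ndv.
  have [p2 a1] : p = 2 /\ a = 1%N.
    by apply: prime_ndvd_bin2 => //; apply: contra ndv; apply: dvdn_mull.
  split=> //; apply/eqP; rewrite eqn_leq -{2}a1 le_ab andbT leqNgt.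
  apply: contra ndv => b_gt1; rewrite a1 -mulnA dvdn_mull // dvdn_mulr //.
  by rewrite dvdn_exp // subn_gt0.
have ox : #[x] = 4 by rewrite oxa p2 a1.
have oy : #[y] = 4 by rewrite oyb p2 b1.
have sq (u : gT) : #[u] = 4 -> c \in <[u]> -> c = u ^+ 2.
  move=> ou /cyclePmin[i]; rewrite ou => lti ec.
  have /eqP := expg_order c; rewrite -/p p2 ec -expgM -order_dvdn ou => dv4.
  by case: i lti ec dv4 => [|[|[|[|]]]] //= _ ec _; rewrite ec expg0 eqxx in c1.
have cx2 : c = x ^+ 2 by apply: sq ox _; apply: commg_in_cyclel cG _ _ Gx Gy.
have cy2 : c = y ^+ 2 by apply: sq oy _; apply: commg_in_cycler cG _ _ Gx Gy.
exists x, y; split=> //; first by rewrite -cx2.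
have: x ^ y = x * c by rewrite /c commgEl mulKVg.
rewrite cx2 -expgS => ->; apply/eqP; rewrite eq_sym eq_invg_mul -expgS -ox.
by rewrite expg_order.
Qed.

(** * The quaternion subgroup and its centralizer *)

Lemma order4_cycle (gT : finGroupType) (u v : gT) :
  #[u] = 4 -> #[v] = 4 -> v \in <[u]> -> v = u \/ v = u^-1.
Proof.
move=> ou ov /cyclePmin[i lti ev].
have uV : u^-1 = u ^+ 3.
  by apply/eqP; rewrite eq_invg_mul -expgS -ou expg_order.
move: lti ov; rewrite ev ou uV; case: i {ev} => [|[|[|[|]]]] // _.
- by rewrite expg0 order1.
- by left.
- by rewrite orderXdiv ou.
- by right.
Qed.

Lemma order_eq4 (gT : finGroupType) (u : gT) :
  (#[u] == 4) = (u ^+ 4 == 1) && (u ^+ 2 != 1).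
Proof.
rewrite -!order_dvdn; apply/eqP/andP=> [-> // | [/(@dvdn_pfactor 2 _ 2 isT)[k]]].
by case: k => [|[|[|]]] // _ ->.
Qed.

Section QuaternionPair.

Variables (gT : finGroupType) (x y : gT).
Hypotheses (ox : #[x] = 4) (y2 : y ^+ 2 = x ^+ 2) (xy : x ^ y = x^-1).

Let Q := <[x]> <*> <[y]>.

Let Qx : x \in Q. Proof. by apply: subsetP (joing_subl _ _) _ (cycle_id x). Qed.
Let Qy : y \in Q. Proof. by apply: subsetP (joing_subr _ _) _ (cycle_id y). Qed.

Let x4 : x ^+ 4 = 1. Proof. by rewrite -ox expg_order. Qed.
Let x2 : x ^+ 2 != 1.
Proof. by have := order_eq4 x; rewrite ox x4 !eqxx => /esym. Qed.

Lemma quaternion_pair_order : #[y] = 4.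
Proof. by apply/eqP; rewrite order_eq4 y2 x2 (expgM y 2 2) y2 -expgM x4 eqxx. Qed.

Lemma quaternion_pair_noncommute : ~ commute x y.
Proof.
move=> /commgP/conjg_fixP/eqP; rewrite xy eq_invg_mul.
exact/negP.
Qed.

Lemma quaternion_pair_conj : y ^ x = y^-1.
Proof.
have yx : y * x = x^-1 * y by rewrite (conjgC _ y) conjVg xy invgK.
have xx_yy : x * x = y * y := esym y2.
by rewrite conjgE yx mulgA -invMg xx_yy invMg mulgKV.
Qed.

(** The order is a multiple of 4 greater than 4, as y is not in <x>; the reverse
bound comes with the presentation of the quaternion group. *)
Lemma quaternion_pair_card : 8 <= #|Q|.
Proof.
have xQ : <[x]> \proper Q.
  rewrite properEneq joing_subl andbT; apply/eqP=> xQ.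
  case: quaternion_pair_noncommute.
  have /cycleP[i ->] : y \in <[x]> by rewrite xQ.
  exact: commuteX.
have := proper_card xQ; have := cardSg (joing_subl <[x]> <[y]>).
by rewrite -orderE ox => /dvdnP[[|[|k]] ->].
Qed.

Lemma quaternion_pair_isog : Q \isog 'Q_8.
Proof.
rewrite isogEcard (card_quaternion (n := 3)) // quaternion_pair_card andbT.
rewrite (Grp_quaternion (n := 3)) //; apply/existsP; exists (x, y) => /=.
by rewrite !xpair_eqE y2 xy [x ^+ (2 ^ 2)]x4 !eqxx.
Qed.

Lemma quaternion_pair_center : 'Z(Q) = <[x ^+ 2]> /\ #|'Z(Q)| = 2.
Proof.
have gens : extremal_generators Q 2 3 (x, y).
  split=> //.
    by rewrite (card_isog quaternion_pair_isog) (card_quaternion (n := 3)).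
  rewrite inE Qy andbT; apply/negP=> /cycleP[i yx].
  by case: quaternion_pair_noncommute; rewrite yx; apply: commuteX.
by have [//|_ _ [-> ? _ _ _] _ _] :=
  quaternion_structure _ gens quaternion_pair_isog.
Qed.

Variable G : {group gT}.
Hypotheses (cG : conj_in_cycle G) (Gx : x \in G) (Gy : y \in G).

Lemma mem_cent_quaternion_pair d :
  (d \in 'C_G(Q)) = [&& d \in G, x ^ d == x & y ^ d == y].
Proof.
rewrite inE centY inE !cent_cycle; congr (_ && (_ && _)).
  apply/cent1P/eqP=> [/commute_sym/commgP/conjg_fixP // | ].
  by move/conjg_fixP/commgP/commute_sym.
apply/cent1P/eqP=> [/commute_sym/commgP/conjg_fixP // | ].
by move/conjg_fixP/commgP/commute_sym.
Qed.

(** Conjugation by an element of G fixes or inverts x, and likewise y; each of the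
four combinations is realized by one of 1, x, y, xy. *)
Lemma quaternion_pair_mul_cent : Q * 'C_G(Q) = G.
Proof.
have sQG : Q \subset G by rewrite join_subG !cycle_subG Gx.
have oy := quaternion_pair_order; have yx := quaternion_pair_conj.
have xx (u : gT) : u ^ u = u by rewrite conjgE mulKg.
apply/eqP; rewrite eqEsubset mul_subG ?subsetIl //=; apply/subsetP=> g Gg.
rewrite -(centC (subsetIr _ _)).
have [q Qq [xq yq]] : exists2 q, q \in Q & x ^ q = x ^ g /\ y ^ q = y ^ g.
  have [-> | ->] : x ^ g = x \/ x ^ g = x^-1.
  - by apply: order4_cycle; rewrite ?orderJ ?cG.
  - have [-> | ->] : y ^ g = y \/ y ^ g = y^-1.
    + by apply: order4_cycle; rewrite ?orderJ ?cG.
    + by exists 1; rewrite ?conjg1.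
    + by exists x; rewrite // xx.
  have [-> | ->] : y ^ g = y \/ y ^ g = y^-1.
  - by apply: order4_cycle; rewrite ?orderJ ?cG.
  - by exists y; rewrite // xx.
  by exists (x * y); rewrite ?groupM // !conjgM xx yx conjVg xx xy.
rewrite -[g](mulgKV q) mem_mulg // mem_cent_quaternion_pair.
by rewrite groupM ?groupV ?(subsetP sQG q) //= !conjgM -xq -yq !conjgK !eqxx.
Qed.

(** The commutator [x d, y] = x^2 must be one of the four powers of x d.  The
zeroth, first and third are excluded, as they would force x^2 = 1, or x = d, or
x^-1 = d^3, whereas d commutes with y; and x^2 = (x d)^2 gives d^2 = 1. *)
Lemma cent_quaternion_pair_sqr d : d \in 'C_G(Q) -> d ^+ 4 = 1 -> d ^+ 2 = 1.
Proof.
rewrite mem_cent_quaternion_pair => /and3P[Gd /eqP xd /eqP yd] d4.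
have cxd : commute x d by apply/commgP/conjg_fixP.
have cyd : commute y d by apply/commgP/conjg_fixP.
have xy2 : [~ x, y] = x ^+ 2.
  rewrite commgEl xy -invMg; apply/eqP; rewrite eq_invg_mul.
  by rewrite -[x * x]/(x ^+ 2) -expgD x4.
have xdX i : (x * d) ^+ i = x ^+ i * d ^+ i by apply: expgMn.
have /cyclePmin[i] : x ^+ 2 \in <[x * d]>.
  have <- : [~ x * d, y] = x ^+ 2.
    rewrite commMgJ xy2 conjXg xd.
    by have /commgP/eqP -> := commute_sym cyd; rewrite mulg1.
  by apply: (commg_in_cyclel cG); rewrite ?groupM.
have dvd4 : #[x * d] %| 4 by rewrite order_dvdn xdX x4 d4 mulg1.
move/leq_trans/(_ (@dvdn_leq _ 4 isT dvd4)).
case: i => [|[|[|[|]]]] // _ ex.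
- by have := x2; rewrite ex expg0 eqxx.
- case: quaternion_pair_noncommute; apply: commute_sym.
  have -> : x = d; last by [].
  by apply: (mulgI x); rewrite -[LHS]/(x ^+ 2) ex.
- by apply: (mulgI (x ^+ 2)); rewrite -xdX -ex mulg1.
case: quaternion_pair_noncommute; apply: commute_sym.
have ed : x * d ^+ 3 = 1.
  by apply: (mulgI (x ^+ 2)); rewrite mulgA -expgSr -xdX -ex mulg1.
rewrite -[x]invgK; apply: commuteV.
by move/eqP: ed; rewrite -eq_invg_mul => /eqP ->; apply: commuteX.
Qed.

End QuaternionPair.

(** * The structure theorem *)

Definition hamiltonian_decomposition
    (gT : finGroupType) (Q E A G : {set gT}) : Prop :=
  [/\ Q \x (E \x A) = G, Q \isog 'Q_8, 2.-abelem E, abelian A & odd #|A|].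

Lemma abelem2_of_pow4 (gT : finGroupType) (P : {group gT}) :
    abelian P -> 2.-group P -> {in P, forall d, d ^+ 4 = 1 -> d ^+ 2 = 1} ->
  2.-abelem P.
Proof.
move=> abP pP sq1; rewrite abelemE // abP /=; apply/exponentP=> d Pd.
have /p_natP[k od] := mem_p_elt pP Pd.
case: k od => [|[|k]] od.
- by move/eqP: od; rewrite order_eq1 => /eqP ->; rewrite expg1n.
- by rewrite -[X in d ^+ X]od expg_order.
have : (d ^+ (2 ^ k)) ^+ 2 = 1.
  by apply: sq1; rewrite ?groupX // -expgM -(expnD 2 k 2) addn2 -od expg_order.
move/eqP; rewrite -expgM -expnSr -order_dvdn od dvdn_Pexp2l //.
by rewrite ltnn.
Qed.

(** The centralizer C of the quaternion subgroup Q is abelian, for otherwise it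
would contain an element of order 4.  Its Sylow 2-subgroup splits over
<x^2> = Q :&: C, so that C = <x^2> x E x A, and G = Q C = Q x E x A. *)
Lemma hamiltonian_decomposes (gT : finGroupType) (G : {group gT}) :
  hamiltonian G ->
  exists Q E A : {group gT}, hamiltonian_decomposition Q E A G.
Proof.
case/andP=> nabG /all_normalP cG.
have [x [y [Gx Gy ox y2 xy]]] := noncommuting_quaternion_pair cG nabG.
pose Q := (<[x]> <*> <[y]>)%G; pose C := 'C_G(Q)%G.
have sqC d : d \in C -> d ^+ 4 = 1 -> d ^+ 2 = 1.
  exact: (cent_quaternion_pair_sqr ox xy cG Gx Gy).
have abC : abelian C.
  have cC : conj_in_cycle C := conj_in_cycleS (subsetIl _ _) cG.
  apply: contraT => /(noncommuting_quaternion_pair cC)[u [v [Cu _ /eqP ou _ _]]].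
  move: ou; rewrite order_eq4 => /andP[/eqP u4 /eqP].
  by rewrite (sqC u).
have nilC := abelian_nil abC.
have abP : 2.-abelem 'O_2(C).
  apply: abelem2_of_pow4 (pcore_pgroup _ _) _.
    exact: abelianS (pcore_sub _ _) abC.
  by move=> d Pd; apply: sqC; apply: subsetP (pcore_sub _ _) _ Pd.
have [ZQ oZ] := quaternion_pair_center ox y2 xy; rewrite -/Q in ZQ oZ.
have Qx : x \in Q by apply: subsetP (joing_subl _ _) _ (cycle_id x).
have sQG : Q \subset G by rewrite join_subG !cycle_subG Gx.
have QC_Z : Q :&: C = <[x ^+ 2]>.
  by rewrite -ZQ /= setIA (setIidPl sQG).
have Pc : <[x ^+ 2]> \subset 'O_2(C).
  have Cc : x ^+ 2 \in C by rewrite -cycle_subG -QC_Z subsetIr.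
  have hallP := nilpotent_pcore_Hall 2 nilC.
  rewrite cycle_subG (mem_normal_Hall hallP) ?pcore_normal //.
  by rewrite /p_elt orderE -ZQ oZ.
have [E defP] := abelem_split_dprod abP Pc.
have defC := nilpotent_pcoreC 2 nilC; rewrite -defP -dprodA in defC.
have [[_ L _ defL] mulcL _ tiL] := dprodP defC.
have sLC : L \subset C by rewrite -mulcL defL mulG_subr.
have sXQ : <[x ^+ 2]> \subset Q by rewrite cycle_subG groupX.
exists Q, E, 'O_2^'(C)%G; split.
- rewrite defL dprodE; last first.
  + by rewrite -(setIidPr sLC) setIA QC_Z -defL.
  + exact: subset_trans sLC (subsetIr _ _).
  have defG : Q * C = G := quaternion_pair_mul_cent ox y2 xy cG Gx Gy.
  by rewrite -defG -mulcL defL mulgA (mulGSid sXQ).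
- exact: quaternion_pair_isog.
- by have := dprod_abelem 2 defP; rewrite abP => /esym/andP[].
- exact: abelianS (pcore_sub _ _) abC.
by rewrite odd_2'nat; apply: pcore_pgroup.
Qed.

(** Every element outside the cyclic subgroup <x> of order 4 also generates a
subgroup of order 4, which is normal as it has index 2; a generator of it is
therefore fixed or inverted by conjugation. *)
Lemma quaternion8_structure (gT : finGroupType) (Q : {group gT}) :
    Q \isog 'Q_8 ->
  [/\ #|Q| = 8, ~~ abelian Q, {in Q, forall u, u ^+ 4 = 1}
    & {in Q &, forall u v, u ^ v = u \/ u ^ v = u^-1}].
Proof.
move=> isoQ.
have oQ : #|Q| = 8 by rewrite (card_isog isoQ) (card_quaternion (n := 3)).
have [//|[x y] gens _] := generators_quaternion (n := 3) _ isoQ.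
have [_ Qx ox _] := gens; rewrite -[(2 ^ _)%N]/4 in ox.
have [//|[_ o4 inv] _ [_ oZ _ _ _] _ _] :=
  quaternion_structure (n := 3) _ gens isoQ.
split=> // [|u Qu|u v Qu Qv].
- by apply/negP=> /center_idP ZQ; rewrite ZQ oQ in oZ.
- apply/eqP; rewrite -order_dvdn; have [Xu | X'u] := boolP (u \in <[x]>).
    by rewrite -ox; apply: order_dvdG Xu.
  by rewrite o4 // inE X'u.
have [Xu | X'u] := boolP (u \in <[x]>).
  have [Xv | X'v] := boolP (v \in <[x]>).
    by left; apply/conjg_fixP/commgP; apply: (centsP (cycle_abelian x)).
  by right; apply: inv; rewrite // inE X'v.
have ou : #[u] = 4 by rewrite o4 // inE X'u.
have sUQ : <[u]> \subset Q by rewrite cycle_subG.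
have nUQ : <[u]> <| Q.
  by apply: index2_normal; rewrite // -divgS // oQ -orderE ou.
apply: order4_cycle; rewrite ?orderJ // memJ_norm ?cycle_id //.
by apply: subsetP (normal_norm nUQ) _ Qv.
Qed.

Lemma partn_pow2_odd e o :
  odd o -> ((2 ^ e * o)`_2 = 2 ^ e)%N /\ ((2 ^ e * o)`_2^' = o)%N.
Proof.
move=> odd_o; have o_gt0 := odd_gt0 odd_o.
have e2 : 2.-nat (2 ^ e)%N by rewrite pnatX pnat_id.
have o2 : 2^'.-nat o by rewrite -odd_2'nat.
rewrite !partnM ?expn_gt0 // !(part_pnat_id e2, part_pnat_id o2).
rewrite (part_p'nat o2) [in X in _ /\ X]part_p'nat ?muln1 ?mul1n //.
by rewrite pnatNK.
Qed.

Section Decomposition.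

Variables (gT : finGroupType) (Q E A G : {group gT}).
Hypothesis decG : hamiltonian_decomposition Q E A G.

(** Write an element as u l with u in Q and l in the abelian group E x A.  Its
conjugates are u l and u^-1 l, and the latter is the power of u l with exponent
2 |A| + 1: it is congruent to 3 mod 4, as |A| is odd, while l^(2 |A|) = 1. *)
Lemma decomposition_hamiltonian : hamiltonian G.
Proof.
have [defG isoQ abE abA oddA] := decG.
have [oQ nabQ Q4 QJ] := quaternion8_structure isoQ.
have [[_ L _ defL] mulQL cQL _] := dprodP defG; rewrite defL in mulQL cQL defG.
have [_ mulEA cEA _] := dprodP defL.
have abL : abelian L by rewrite -mulEA abelianM (abelem_abelian abE) abA.
apply/andP; split.
  by apply: contra nabQ; apply: abelianS; rewrite -mulQL mulG_subl.
apply/all_normalP=> h g; rewrite -mulQL.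
case/mulsgP=> u l Qu Ll -> /mulsgP[v m Qv Lm ->].
have fixL q k : q \in Q -> k \in L -> q ^ k = q.
  by move=> Qq Lk; apply/conjg_fixP/commgP/commute_sym; apply: (centsP cQL).
have fixQ q k : q \in Q -> k \in L -> k ^ q = k.
  by move=> Qq Lk; apply/conjg_fixP/commgP; apply: (centsP cQL).
have -> : (u * l) ^ (v * m) = u ^ v * l.
  rewrite conjMg !conjgM (fixL (u ^ v) m) ?groupJ // (fixQ v l) //.
  congr (_ * _).
  by apply/conjg_fixP/commgP; apply: (centsP abL).
case: (QJ u v Qu Qv) => ->; first exact: cycle_id.
suff -> : u^-1 * l = (u * l) ^+ (2 * #|A|).+1 by apply: mem_cycle.
rewrite expgMn; last by apply: commute_sym; apply: (centsP cQL).
congr (_ * _).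
  have dvd4 : ((2 * #|A|).+2 = 4 * #|A|./2.+1)%N.
    by rewrite -{1}(odd_double_half #|A|) oddA -mul2n mulnDr mulnA (mulnS 4).
  by apply/eqP; rewrite eq_invg_mul -expgS dvd4 expgM Q4 // expg1n.
have : l \in E * A by rewrite mulEA.
case/mulsgP=> e a Ee Aa el; rewrite expgS.
suff -> : l ^+ (2 * #|A|) = 1 by rewrite mulg1.
rewrite el expgMn; last by apply: commute_sym; apply: (centsP cEA).
have [_ /(_ e Ee) e2] := abelemP (isT : prime 2) abE.
by rewrite expgM e2 expg1n mul1g mulnC expgM (expg_cardG Aa) expg1n.
Qed.

Lemma decomposition_card : #|G| = (8 * #|E| * #|A|)%N.
Proof.
have [defG isoQ _ _ _] := decG; have [oQ _ _ _] := quaternion8_structure isoQ.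
rewrite -(dprod_card defG) oQ -mulnA.
by have [[_ L _ defL] _ _ _] := dprodP defG; rewrite (dprod_card defL) defL.
Qed.

Lemma decomposition_odd_core : 'O_2^'(G) = A.
Proof.
have [defG _ abE _ oddA] := decG.
have [[_ L _ defL] mulQL _ _] := dprodP defG; have [_ mulEA _ _] := dprodP defL.
have sAG : A \subset G.
  by rewrite -mulQL defL (subset_trans _ (mulG_subr _ _)) // -mulEA mulG_subr.
have nAG : A <| G.
  by case/andP: decomposition_hamiltonian => _ /forall_inP; apply.
apply: normal_Hall_pcore nAG; rewrite pHallE sAG decomposition_card.
rewrite (card_pgroup (abelem_pgroup abE)) -(expnD 2 3).
by have [_ ->] := partn_pow2_odd (3 + logn 2 #|E|) oddA; rewrite /= eqxx.
Qed.

Lemma decomposition_order e o : #|G| = (2 ^ e * o)%N -> odd o ->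
  [/\ 2 < e, #|E| = (2 ^ (e - 3))%N & #|A| = o].
Proof.
have [_ _ abE _ oddA] := decG; rewrite decomposition_card => oG odd_o.
rewrite (card_pgroup (abelem_pgroup abE)) -(expnD 2 3) in oG.
have [] := partn_pow2_odd (3 + logn 2 #|E|) oddA.
have [] := partn_pow2_odd e odd_o; rewrite oG => -> -> /eqP.
rewrite eqn_exp2l // => /eqP -> ->; split; rewrite ?leq_addr //.
by rewrite addKn -card_pgroup ?(abelem_pgroup abE).
Qed.

End Decomposition.

(** The factors E and E' have the same order because |G| = 8 |E| |A|, and an
elementary abelian group is determined by its order. *)
Lemma decomposition_isog (gT rT : finGroupType)
    (Q E A G : {group gT}) (Q' E' A' G' : {group rT}) :
    hamiltonian_decomposition Q E A G ->
    hamiltonian_decomposition Q' E' A' G' ->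
  #|G| = #|G'| -> A \isog A' -> G \isog G'.
Proof.
move=> decG decG' oGG' isoA.
have oEE' : #|E'| = #|E|.
  apply/eqP; rewrite -(eqn_pmul2l (isT : 0 < 8)) -(eqn_pmul2r (cardG_gt0 A)).
  rewrite -(decomposition_card decG) oGG' (decomposition_card decG').
  by rewrite (card_isog isoA).
have [[defG isoQ abE _ _] [defG' isoQ' abE' _ _]] := (decG, decG').
have [[_ L _ defL] _ _ _] := dprodP defG.
have [[_ L' _ defL'] _ _ _] := dprodP defG'.
apply: (isog_dprod defG defG').
  by apply: isog_trans isoQ _; rewrite isog_sym.
rewrite defL defL'; apply: (isog_dprod defL defL') isoA.
by rewrite (isog_abelem_card _ abE) abE' oEE' eqxx.
Qed.

(** * Counting isomorphism classes *)

Lemma exists_decomposition k (aT : finGroupType) (A0 : {group aT}) :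
    abelian A0 -> odd #|A0| ->
  exists (gT : finGroupType) (Q E A G : {group gT}),
    [/\ hamiltonian_decomposition Q E A G, A0 \isog A & #|E| = (2 ^ k)%N].
Proof.
move=> abA oddA.
pose V : finGroupType := 'rV['F_2]_k.
have abV : 2.-abelem [set: V] by apply: fin_Fp_lmod_abelem.
have oV : #|[set: V]| = (2 ^ k)%N by rewrite cardsT card_mx card_Fp // mul1n.
pose W : finGroupType := (V * aT)%type.
(* The external product E x A is built first, then embedded as the second
   factor of the product with the quaternion group. *)
pose f := pair1g_morphism (quaternion_gtype 8) W.
pose E1 := setX_group [set: V]%G (one_group aT).
pose A1 := setX_group (one_group V) A0.
have isoE : [set: V] \isog f @* E1.
  apply: isog_trans (isog_setX1 _ _) _.
  exact: sub_isog (subsetT _) (injm_pair1g _ _).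
have isoA : A0 \isog f @* A1.
  apply: isog_trans (isog_set1X _ _) _.
  exact: sub_isog (subsetT _) (injm_pair1g _ _).
pose Q := setX_group 'Q_8%G (one_group W).
pose G := setX_group 'Q_8%G (setX_group [set: V]%G A0).
exists (quaternion_gtype 8 * W)%type, Q, (f @* E1)%G, (f @* A1)%G, G.
split=> //; last by rewrite -(card_isog isoE).
split; last 1 first.
- by rewrite -(card_isog isoA).
- rewrite (injm_dprod (subsetT _) (injm_pair1g _ _) (setX_dprod _ _)).
  by rewrite morphim_pair1g; apply: setX_dprod.
- by rewrite isog_sym isog_setX1.
- by rewrite -(isog_abelem isoE).
by rewrite -(isog_abelian isoA).
Qed.

Local Close Scope group_scope.

Theorem proposition2 (n e o : nat) (hn : 1 <= n) (hneo : n = 2 ^ e * o)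
    (ho : odd o) :
  num_hamiltonian n = if e < 3 then 0 else num_abelian o.
Proof.
have [H [hamH injH surjH]] := num_isoclassesP n hamiltonian_isog.
rewrite -/(num_hamiltonian n) in H hamH injH surjH.
have [B [abB injB surjB]] := num_isoclassesP o isog_abelian.
rewrite -/(num_abelian o) in B abB injB surjB.
have oH i : #|H i| = (2 ^ e * o)%N by rewrite -hneo; case: (hamH i).
pose oddPart i j := exists Q E A : {group 'S_n},
  hamiltonian_decomposition Q E A (H i) /\ A \isog B j.
have [f fP] : exists f, forall i, oddPart i (f i).
  apply: fin_all_exists => i; have [_ /hamiltonian_decomposes] := hamH i.
  case=> Q [E [A decH]]; have [_ _ _ abA _] := decH.
  have [_ _ oA] := decomposition_order decH (oH i) ho.
  by have [j isoA] := surjB _ A oA abA; exists j, Q, E, A.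
have [e_lt3 | e_ge3] := ltnP e 3.
  case: (posnP (num_hamiltonian n)) => // h_gt0.
  have [Q [E [A [decH _]]]] := fP (Ordinal h_gt0).
  by have [] := decomposition_order decH (oH _) ho; rewrite ltnNge -ltnS e_lt3.
have [g gP] : exists g, forall j, B j \isog 'O_2^'(H (g j))%g.
  apply: (fin_all_exists (P := fun j i => B j \isog 'O_2^'(H i)%g)) => j.
  have [oB abBj] := abB j.
  have oddB : odd #|B j| by rewrite oB.
  have [gT [Q [E [A [G [decG isoA oE]]]]]] :=
    exists_decomposition (e - 3) abBj oddB.
  have oG : #|G| = n.
    rewrite (decomposition_card decG) oE -(card_isog isoA) oB hneo.
    by rewrite -(expnD 2 3) subnKC.
  have [i isoG] := surjH _ G oG (decomposition_hamiltonian decG); exists i.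
  apply: isog_trans isoA _; rewrite -(decomposition_odd_core decG).
  exact: isog_pcore.
(* f and g need not be mutually inverse: two injections suffice. *)
apply/eqP; rewrite eqn_leq -[num_hamiltonian n]card_ord -[num_abelian o]card_ord.
apply/andP; split.
  apply: (leq_card f) => i j eq_f; apply: injH.
  have [Q [E [A [decH isoA]]]] := fP i.
  have [Q' [E' [A' [decH' isoA']]]] := fP j.
  apply: decomposition_isog decH decH' _ _; first by rewrite !oH.
  by apply: isog_trans isoA _; rewrite eq_f isog_sym.
apply: (leq_card g) => i j eq_g; apply: injB.
by apply: isog_trans (gP i) _; rewrite eq_g isog_sym.
Qed.
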